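(* Let $Y$ be a real topological vector space, $A\subseteq Y$ and $k\in(-0^+A)\setminus\{0\}$. (1) The following conditions are equivalent to each other: (a) $\varphi_{A,k}$ is lower semicontinuous. (b) $\operatorname{cl}_k A=\operatorname{cl}A$. (c) $\{y\in Y:\varphi_{A,k}(y)\le t\}=\operatorname{cl}A+tk$ holds for all $t\in\mathbb{R}$. (d) $\operatorname{cl}A-\mathbb{R}_{>}k\subseteq A$. (2) $\varphi_{A,k}$ is continuous if and only if $\operatorname{cl}A-\mathbb{R}_{>}k\subseteq\operatorname{int}A$.
   Context: $\mathbb{R}_{+}=\{x\in\mathbb{R}:x\ge 0\}$, $\mathbb{R}_{>}=\{x\in\mathbb{R}:x>0\}$, $\overline{\mathbb{R}}=\mathbb{R}\cup\{-\infty,+\infty\}$, and $\inf\emptyset=+\infty$. For $B\subseteq\mathbb{R}$ and $k\in Y$, $Bk=\{bk:b\in B\}$. The recession cone of $A$ is $0^+A=\{u\in Y: A+\mathbb{R}_{+}u\subseteq A\}$, and $-0^+A=\{-u:u\in 0^+A\}$. $\operatorname{int}A$ and $\operatorname{cl}A$ are the topological interior and closure. For $k\in Y\setminus\{0\}$, the $k$-directional closure $\operatorname{cl}_k(A)$ is the set of all $y\in Y$ such that for each $\lambda\in\mathbb{R}_{>}$ there exists $t\in\mathbb{R}_{+}$ with $t<\lambda$ and $y-tk\in A$. The Gerstewitz functional $\varphi_{A,k}:Y\to\overline{\mathbb{R}}$ is $\varphi_{A,k}(y)=\inf\{t\in\mathbb{R}: y\in A+tk\}$. Continuity and lower semicontinuity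 are meant for functions on $Y$ with values in $\overline{\mathbb{R}}$ (with its usual order topology). *)

(* Defs.v *)
(* A real topological vector space over R : realType is a
   Y : topologicalLmodType R: addition and scaling are jointly continuous, with
   neither local convexity nor separation assumed (unlike tvsType, which is
   locally convex). *)
From HB Require Import structures.
From mathcomp Require Import all_boot all_order all_algebra.
From mathcomp Require Import all_classical all_reals all_analysis.
Set Implicit Arguments.
Unset Strict Implicit.
Unset Printing Implicit Defensive.
Import Order.TTheory GRing.Theory Num.Theory.
Import numFieldNormedType.Exports.
Local Open Scope classical_set_scope.
Local Open Scope ring_scope.

Definition Rnonneg (R : realType) : set R := [set t | 0 <= t].
Definition Rpos (R : realType) : set R := [set t | 0 < t].

Definition mink_add (Y : zmodType) (A B : set Y) : set Y :=
  [set a + b | a in A & b in B].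

(* The set of differences, not the set difference. *)
Definition mink_sub (Y : zmodType) (A B : set Y) : set Y :=
  [set a - b | a in A & b in B].

Definition scalars_mul (R : realType) (Y : lmodType R) (B : set R) (k : Y) :
    set Y :=
  [set b *: k | b in B].

Definition recession_cone (R : realType) (Y : lmodType R) (A : set Y) : set Y :=
  [set u | mink_add A (scalars_mul (@Rnonneg R) u) `<=` A].

Definition dir_closure (R : realType) (Y : lmodType R) (k : Y) (A : set Y) :
    set Y :=
  [set y | forall lambda : R, 0 < lambda ->
     exists t : R, [/\ 0 <= t, t < lambda & A (y - t *: k)]].

(* ereal_inf set0 = +oo. *)
Definition gerstewitz (R : realType) (Y : lmodType R) (A : set Y) (k : Y) :
    Y -> \bar R :=
  fun y => ereal_inf [set t%:E | t in [set t : R | mink_add A [set t *: k] y]].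

(* Main.v *)
(* Since [A - R_+ k] is contained in [A], the value of the functional at [y]
   is at most [t] iff [y - s k] lies in [A] for every [s > t], i.e. iff
   [y - t k] lies in the k-directional closure of [A]. Sublevel sets are
   therefore translates of [cl_k A], which always lies in [cl A], so lower
   semicontinuity amounts to [cl_k A] being closed. For (2), the extra
   condition on the interior of [A] is what makes the strict sublevel sets
   open. *)
Require Import Defs.
From HB Require Import structures.
From mathcomp Require Import all_boot all_order all_algebra.
From mathcomp Require Import all_classical all_reals all_analysis.
Set Implicit Arguments.
Unset Strict Implicit.
Unset Printing Implicit Defensive.
Import Order.TTheory GRing.Theory Num.Theory.
Import numFieldNormedType.Exports.
Local Open Scope classical_set_scope.
Local Open Scope ring_scope.

Lemma continuous_lower_semicontinuous (X : topologicalType) (R : realType)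
    (f : X -> \bar R) :
  continuous f -> lower_semicontinuous f.
Proof.
move=> cf; apply/lower_semicontinuousP => a.
by move/continuousP : cf => /(_ [set y | (a%:E < y)%E]); apply;
  exact: open_ereal_gt_ereal.
Qed.

(** Neighbourhoods in [\bar R] are generated by open rays. At a finite value one ray from each side
    is intersected; at [+oo] or [-oo] a single ray, hence one of the two semicontinuities,
    suffices. *)
Lemma semicontinuous_continuous (X : topologicalType) (R : realType)
    (f : X -> \bar R) :
  lower_semicontinuous f -> (forall a : R, open [set x | (f x < a%:E)%E]) ->
  continuous f.
Proof.
move=> lscf uscf x.
have near_gt (a : R) : (a%:E < f x)%E -> \forall y \near x, (a%:E < f y)%E.
  by move=> /lscf[V xV Vf]; exact: filterS xV.
have near_lt (a : R) : (f x < a%:E)%E -> \forall y \near x, (f y < a%:E)%E.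
  by move=> fxa; exact: (open_nbhs_nbhs (conj (uscf a) fxa)).
move=> U; rewrite /nbhs/= /ereal_nbhs/=.
case fxE: (f x) near_gt near_lt => [r| |] near_gt near_lt.
- move=> [e/= e0 reU].
  have rl : \forall y \near x, ((r - e)%:E < f y)%E.
    by apply: near_gt; rewrite lte_fin ltrBlDr ltrDl.
  have rr : \forall y \near x, (f y < (r + e)%:E)%E.
    by apply: near_lt; rewrite lte_fin ltrDl.
  apply: filterS2 rl rr => y /=; case: (f y) => [s| |]//.
  by rewrite !lte_fin => rs sr; apply: reU; rewrite /= distrC ltr_distl rs sr.
- move=> [M [_ MU]]; apply: (filterS _ (near_gt M _)); last exact: ltry.
  by move=> y /MU.
- move=> [M [_ MU]]; apply: (filterS _ (near_lt M _)); last exact: ltNyr.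
  by move=> y /MU.
Qed.

Lemma mink_add_set1P (Y : zmodType) (A : set Y) (z y : Y) :
  mink_add A [set z] y <-> A (y - z).
Proof.
split=> [[a Aa [_ -> <-]]|Ayz]; first by rewrite addrK.
by exists (y - z) => //; exists z => //; rewrite subrK.
Qed.

Lemma mink_sub_RposP (R : realType) (Y : lmodType R) (A B : set Y) (k : Y) :
  mink_sub A (scalars_mul (@Rpos R) k) `<=` B <->
  forall y (s : R), A y -> 0 < s -> B (y - s *: k).
Proof.
split=> [AB y s Ay s0|AB _ [y Ay [_ [s s0 <-] <-]]]; last exact: AB.
by apply: AB; exists y => //; exists (s *: k) => //; exists s.
Qed.

(** The form in which the hypothesis on [k] is used: [A] is stable under moving along [- k], so any
    [s] with [y - s *: k] in [A] may be increased. *)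
Lemma recession_cone_oppP (R : realType) (Y : lmodType R) (A : set Y) (k : Y) :
  (-%R @` recession_cone A) k ->
  forall y (s : R), 0 <= s -> A y -> A (y - s *: k).
Proof.
move=> [u uA <-] y s s0 Ay; rewrite scalerN opprK.
by apply: uA; exists y => //; exists (s *: u) => //; exists s.
Qed.

Lemma subrZ_subZ (R : pzRingType) (Y : lmodType R) (y k : Y) (s r : R) :
  y - s *: k - (r - s) *: k = y - r *: k.
Proof. by rewrite scalerBl opprB addrA subrK. Qed.

Section Gerstewitz.
Context {R : realType}.

Lemma gerstewitz_le (Y : lmodType R) (A : set Y) (k y : Y) (t : R) :
  A (y - t *: k) -> (gerstewitz A k y <= t%:E)%E.
Proof.
move=> Ay; apply: ereal_inf_lbound; exists t => //=.
exact/mink_add_set1P.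
Qed.

Lemma gerstewitz_lt (Y : lmodType R) (A : set Y) (k y : Y) (x : \bar R) :
  (gerstewitz A k y < x)%E -> exists2 t : R, A (y - t *: k) & (t%:E < x)%E.
Proof. by move=> /ereal_inf_lt[_ [t /mink_add_set1P Ay <-] tx]; exists t. Qed.

Lemma subset_dir_closure (Y : lmodType R) (A : set Y) (k : Y) :
  A `<=` dir_closure k A.
Proof. by move=> y Ay l l0; exists 0; rewrite scale0r subr0. Qed.

Lemma gerstewitz_sublevel (Y : lmodType R) (A : set Y) (k : Y)
    (Ak : forall y (s : R), 0 <= s -> A y -> A (y - s *: k)) (t : R) :
  [set y | (gerstewitz A k y <= t%:E)%E] =
  mink_add (dir_closure k A) [set t *: k].
Proof.
apply/seteqP; split=> y /=.
  move=> yt; apply/mink_add_set1P => l l0.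
  have /gerstewitz_lt[s Ays] : (gerstewitz A k y < (t + l / 2)%:E)%E.
    by rewrite (le_lt_trans yt)// lte_fin ltrDl divr_gt0.
  (* The infimum only supplies some [s < t + l / 2]; stability of [A] raises it to exactly
     [t + l / 2]. Halving keeps the offset strictly below [l]. *)
  rewrite lte_fin => stl; exists (l / 2); split.
  - by rewrite divr_ge0// ltW.
  - by rewrite gtr_pMr// invf_lt1// ltr1n.
  - have := Ak _ (t + l / 2 - s) _ Ays.
    rewrite subr_ge0 => /(_ (ltW stl)).
    by rewrite subrZ_subZ scalerDl opprD addrA.
move=> /mink_add_set1P ytA; apply/lee_addgt0Pr => e e0.
have [s [s0 se As]] := ytA _ e0; rewrite -EFinD.
apply: (le_trans (y := (t + s)%:E)); last by rewrite lee_fin lerD2l ltW.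
by apply: gerstewitz_le; rewrite scalerDl opprD addrA.
Qed.

Context {Y : topologicalLmodType R}.
Implicit Types (A : set Y) (k y z : Y).

Lemma continuous_subl z : continuous (fun y => y - z).
Proof.
move=> y; apply: (@continuous_comp _ _ _ (fun y => (y, z))
  (fun x : Y * Y => x.1 - x.2)); last exact: sub_continuous.
by apply: cvg_pair => /=; [exact: cvg_id|exact: cvg_cst].
Qed.

Lemma continuous_subZ y k : continuous (fun t : R => y - t *: k).
Proof.
move=> t; apply: (@continuous_comp _ _ _ (fun t : R => (y, t *: k))
  (fun x : Y * Y => x.1 - x.2)); last exact: sub_continuous.
apply: cvg_pair => /=; first exact: cvg_cst.
(* Joint continuity of scaling views the scalars as the module [R^o] over themselves, hence the
   cast. *)
apply: (@continuous_comp _ _ _ (fun t : R => (t : R^o, k))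
  (fun x : R^o * Y => x.1 *: x.2)); last exact: scale_continuous.
apply: (@cvg_pair _ _ _ _ (nbhs (t : R^o))); first exact: cvg_id.
exact: cvg_cst.
Qed.

(** The points [y - t *: k] tend to [y] as [t] tends to 0, so every neighbourhood of [y] contains
    those with [t] small enough. *)
Lemma dir_closure_subset_closure A k : dir_closure k A `<=` closure A.
Proof.
move=> y Ay U yU.
have [e/= e0 eU] : nbhs (0 : R) (fun t => U (y - t *: k)).
  by apply: continuous_subZ; rewrite scale0r subr0.
have [t [t0 te Ayt]] := Ay _ e0; exists (y - t *: k); split=> //.
by apply: eU; rewrite /= sub0r normrN ger0_norm.
Qed.

Lemma lower_semicontinuous_gerstewitzP A k
    (Ak : forall y (s : R), 0 <= s -> A y -> A (y - s *: k)) :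
  lower_semicontinuous (gerstewitz A k) <-> closed (dir_closure k A).
Proof.
have level t : ~` [set y | (t%:E < gerstewitz A k y)%E] =
    (fun y => y - t *: k) @^-1` dir_closure k A.
  rewrite (_ : ~` _ = [set y | (gerstewitz A k y <= t%:E)%E]).
    rewrite gerstewitz_sublevel//.
    by apply/seteqP; split=> y /mink_add_set1P.
  by apply/seteqP; split=> y /=; rewrite leNgt => /negP.
(* Level 0 alone gives back [dir_closure k A]; conversely, each sublevel set is its preimage under a
   continuous translation. *)
split=> [/lower_semicontinuousP/(_ 0)|clA].
  rewrite -closedC level (_ : _ @^-1` _ = dir_closure k A)//.
  by apply/seteqP; split=> y /=; rewrite scale0r subr0.
apply/lower_semicontinuousP => t; rewrite -closedC level.
by move/continuous_closedP : (@continuous_subl (t *: k)); exact.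
Qed.

Lemma dir_closure_closure A k :
  mink_sub (closure A) (scalars_mul (@Rpos R) k) `<=` A ->
  dir_closure k A = closure A.
Proof.
move/mink_sub_RposP => clA; apply/seteqP; split.
  exact: dir_closure_subset_closure.
move=> y Ay l l0; exists (l / 2); split.
- by rewrite divr_ge0// ltW.
- by rewrite gtr_pMr// invf_lt1// ltr1n.
- by apply: clA; rewrite ?divr_gt0.
Qed.

Lemma open_gerstewitz_lt A k (t : R) :
  mink_sub (closure A) (scalars_mul (@Rpos R) k) `<=` interior A ->
  open [set y | (gerstewitz A k y < t%:E)%E].
Proof.
move/mink_sub_RposP => clA; rewrite openE => y /= /gerstewitz_lt[s Ays].
(* The midpoint leaves room on both sides: [s < r] pushes [y - r *: k] into the interior of [A], and
   [r < t] keeps the bound [r], valid at all [z] near [y], strictly below [t]. *)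
rewrite lte_fin => st; pose r := (s + t) / 2.
have [sr rt] := midf_lt st.
have rA : interior A (y - r *: k).
  rewrite -(subrZ_subZ y k s r).
  by apply: clA; [exact: subset_closure|rewrite subr_gt0].
apply: (@filterS _ (nbhs y) _ ((fun z => z - r *: k) @^-1` A)); last first.
  exact: (@continuous_subl (r *: k) y _ rA).
move=> z /= Az.
by apply: (le_lt_trans (gerstewitz_le Az)); rewrite lte_fin.
Qed.

(** Moving by [- s *: k] from a point of the closure makes the functional negative, and the open set
    where it is negative lies in [A], hence in its interior. *)
Lemma gerstewitz_usc_interior A k :
  (forall y, closure A y -> (gerstewitz A k y <= 0)%E) ->
  open [set y | (gerstewitz A k y < 0)%E] ->
  (forall y (s : R), 0 <= s -> A y -> A (y - s *: k)) ->
  mink_sub (closure A) (scalars_mul (@Rpos R) k) `<=` interior A.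
Proof.
move=> cl0 op Ak; apply/mink_sub_RposP => y s Ay s0.
have sub : [set y | (gerstewitz A k y < 0)%E] `<=` A.
  move=> z /= /gerstewitz_lt[t Azt]; rewrite lte_fin => t0.
  have := Ak _ (- t) _ Azt; rewrite oppr_ge0 scaleNr opprK subrK; apply.
  exact: ltW.
move: sub; rewrite open_subsetE//; apply => /=.
have /gerstewitz_lt[t Ayt] : (gerstewitz A k y < s%:E)%E.
  by apply: (le_lt_trans (cl0 _ Ay)); rewrite lte_fin.
(* Subtracting [(t - s) *: k] from [y - s *: k] gives [y - t *: k], which is in [A]. *)
rewrite lte_fin => ts; apply: (@le_lt_trans _ _ (t - s)%:E).
  by apply: gerstewitz_le; rewrite scalerBl opprB addrA subrK.
by rewrite lte_fin subr_lt0.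
Qed.

End Gerstewitz.

Theorem theorem3 (R : realType) (Y : topologicalLmodType R) (A : set Y) (k : Y)
    (hk : ((-%R @` recession_cone A) `\ (0 : Y)) k) :
  [<-> lower_semicontinuous (gerstewitz A k);
       dir_closure k A = closure A;
       forall t : R, [set y | (gerstewitz A k y <= t%:E)%E] =
                     mink_add (closure A) [set t *: k];
       mink_sub (closure A) (scalars_mul (@Rpos R) k) `<=` A]
  /\
  (continuous (gerstewitz A k) <->
   mink_sub (closure A) (scalars_mul (@Rpos R) k) `<=` interior A).
Proof.
have Ak := recession_cone_oppP (proj1 hk).
have lsc_dir : lower_semicontinuous (gerstewitz A k) ->
    dir_closure k A = closure A.
  move/(lower_semicontinuous_gerstewitzP Ak) => clA; apply/seteqP; split.
    exact: dir_closure_subset_closure.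
  (* A closed set containing [A] contains [closure A]. *)
  rewrite [X in _ `<=` X](iffLR (closure_id _) clA).
  exact/closureS/subset_dir_closure.
have sub_lsc : mink_sub (closure A) (scalars_mul (@Rpos R) k) `<=` A ->
    lower_semicontinuous (gerstewitz A k).
  move=> clA; apply/(lower_semicontinuous_gerstewitzP Ak).
  by rewrite dir_closure_closure//; exact: closed_closure.
split; first tfae.
- exact: lsc_dir.
- by move=> dirA t; rewrite gerstewitz_sublevel// dirA.
- move=> level; apply/mink_sub_RposP => y s Ay s0.
  (* The level identity at 0 bounds the functional by 0 on [closure A], so some [t < s] has
     [y - t *: k] in [A]; stability then raises [t] to [s]. *)
  have : mink_add (closure A) [set (0 : R) *: k] y.
    by apply/mink_add_set1P; rewrite scale0r subr0.
  rewrite -level/= => y0.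
  have /gerstewitz_lt[t Ayt] : (gerstewitz A k y < s%:E)%E.
    by apply: (le_lt_trans y0); rewrite lte_fin.
  rewrite lte_fin => ts; have := Ak _ (s - t) _ Ayt.
  rewrite subr_ge0 => /(_ (ltW ts)).
  by rewrite subrZ_subZ.
- exact: sub_lsc.
split=> [cphi|intA].
  apply: gerstewitz_usc_interior => //; last first.
    by move/continuousP : cphi => /(_ [set y | (y < 0)%E]); apply;
      exact: open_ereal_lt_ereal.
  (* Continuity includes lower semicontinuity, so [closure A] is the directional closure, which is
     the sublevel set at 0. *)
  move=> y; rewrite -lsc_dir; last exact: continuous_lower_semicontinuous.
  move=> Ay; have /seteqP[_] := gerstewitz_sublevel Ak 0; apply.
  by apply/mink_add_set1P; rewrite scale0r subr0.
apply: semicontinuous_continuous => [|t]; last exact: open_gerstewitz_lt.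
by apply: sub_lsc; exact: (subset_trans intA (@interior_subset _ _)).
Qed.
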